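(* Let $\mathcal{R}_1,\mathcal{R}_2,\mathcal{S}$ be TRSs and $L$ a set of terms each of which is terminating with respect to $\to_{(\mathcal{R}_1\cup\mathcal{R}_2)/\mathcal{S}}$. Suppose there exist a complexity pair $(\succ,\succsim)$ and a constant $\Delta$ such that $\mathcal{R}_2\subseteq\succ$, $\mathcal{S}\subseteq\succsim$, and for all terms $u,v$, $u\to_{\mathcal{R}_1}v$ implies $\mathrm{dl}(u,\succ)+\Delta\ge\mathrm{dl}(v,\succ)$. Then \[ \mathrm{cp}(n,\to_{(\mathcal{R}_1\cup\mathcal{R}_2)/\mathcal{S}},L)=O\bigl(\mathrm{cp}(n,\to_{\mathcal{R}_1/(\mathcal{R}_2\cup\mathcal{S})},L)+\mathrm{cp}(n,\succ,L)\bigr). \]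
   Context: A TRS is a set of rewrite rules; $\to_{\mathcal{R}}$ is the rewrite relation of $\mathcal{R}$. A rewrite relation is a binary relation on terms closed under contexts and substitutions. A complexity pair $(\succ,\succsim)$ consists of two finitely branching rewrite relations that are compatible: $\succsim\cdot\succ\subseteq\succ$ and $\succ\cdot\succsim\subseteq\succ$. For TRSs $\mathcal{R},\mathcal{S}$: $\to_{\mathcal{R}/\mathcal{S}}=\to_{\mathcal{S}}^*\cdot\to_{\mathcal{R}}\cdot\to_{\mathcal{S}}^*$. $\mathrm{dl}(t,\to)=\sup\{m\mid\exists u,\ t\to^m u\}$; $\mathrm{cp}(n,\to,L)=\sup\{\mathrm{dl}(t,\to)\mid t\in L,|t|\le n\}$ with $|t|$ the size of $t$. $f(n)=O(g(n))$ means $f(n)\le M g(n)$ for all $n\ge N$, for some constants $M,N$. *)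

(* Defs.v *)
From mathcomp Require Import all_boot all_order all_algebra.
From mathcomp Require Import mathcomp_extra boolp classical_sets cardinality.
From mathcomp Require Import constructive_ereal reals ereal.

Set Implicit Arguments.
Unset Strict Implicit.
Unset Printing Implicit Defensive.

Import Order.TTheory GRing.Theory Num.Theory.
Local Open Scope classical_set_scope.

(* Binary relations on T are sets of pairs: a TRS, the relation -> it induces
   and the orders all live in [set (term * term)], so that an inclusion such as
   "R is a subset of >" is literally set inclusion. *)
Section Relations.
Variable T : Type.
Implicit Types (A B : set (T * T)) (t : T).

(* First an A-step, then a B-step; the library's [B \; A] of relation_scope has
   the opposite reading order. *)
Definition rcomp A B : set (T * T) :=
  [set p | exists2 u, A (p.1, u) & B (u, p.2)].

Fixpoint rpow A (m : nat) : set (T * T) :=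
  if m is m'.+1 then rcomp A (rpow A m') else diagonal.

Definition rstar A : set (T * T) := \bigcup_m rpow A m.

Definition terminating A t : Prop :=
  ~ exists s : nat -> T, s 0 = t /\ forall i, A (s i, s i.+1).

Definition finitely_branching A : Prop :=
  forall t, finite_set [set u | A (t, u)].

End Relations.

Section Terms.
Variables (F : Type) (ar : F -> nat) (V : Type).

Inductive term : Type :=
| Var of V
| App (f : F) of {ffun 'I_(ar f) -> term}.

Fixpoint tsize (t : term) : nat :=
  match t with
  | Var _ => 1
  | App f ts => (\sum_(i < ar f) tsize (ts i)).+1
  end.

Fixpoint vars (t : term) : set V :=
  match t with
  | Var x => [set x]
  | App f ts => [set x | exists i : 'I_(ar f), vars (ts i) x]
  end.

Fixpoint subst (s : V -> term) (t : term) : term :=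
  match t with
  | Var x => s x
  | App f ts => App [ffun i => subst s (ts i)]
  end.

(* In [CApp i ts C] the subcontext C sits at argument i and [ts] gives the other
   arguments; the value of [ts] at i is ignored. *)
Inductive ctx : Type :=
| Hole
| CApp (f : F) (i : 'I_(ar f)) of {ffun 'I_(ar f) -> term} & ctx.

Fixpoint fill (C : ctx) (t : term) : term :=
  match C with
  | Hole => t
  | CApp f i ts C' => App [ffun j => if j == i then fill C' t else ts j]
  end.

Implicit Types R S A gt ge : set (term * term).

Definition is_rule (l r : term) : Prop :=
  (forall x, l <> Var x) /\ vars r `<=` vars l.

(* Neither the signature nor the set of rules is assumed to be finite. *)
Definition is_TRS R : Prop := forall l r, R (l, r) -> is_rule l r.

Definition rstep R : set (term * term) :=
  [set p | exists C s l r,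
     [/\ R (l, r), p.1 = fill C (subst s l) & p.2 = fill C (subst s r)]].

Definition rstep_rel R S : set (term * term) :=
  rcomp (rstar (rstep S)) (rcomp (rstep R) (rstar (rstep S))).

Definition rewrite_relation A : Prop :=
  (forall C u v, A (u, v) -> A (fill C u, fill C v)) /\
  (forall s u v, A (u, v) -> A (subst s u, subst s v)).

Record complexity_pair gt ge : Prop := ComplexityPair {
  cpair_gt : rewrite_relation gt;
  cpair_ge : rewrite_relation ge;
  cpair_gt_fin : finitely_branching gt;
  cpair_ge_fin : finitely_branching ge;
  cpair_compatl : rcomp ge gt `<=` gt;
  cpair_compatr : rcomp gt ge `<=` gt
}.

End Terms.

(* Suprema are taken among the natural numbers extended with infinity, embedded
   in the extended reals. *)
Section Complexity.
Local Open Scope ereal_scope.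
Variable K : realType.

Definition dl (T : Type) (t : T) (A : set (T * T)) : \bar K :=
  ereal_sup [set m%:R%:E | m in [set m : nat | exists u, rpow A m (t, u)]].

(* The element 0 makes the supremum 0, rather than -oo, when L has no term of
   size at most n. *)
Definition cp (F : Type) (ar : F -> nat) (V : Type) (n : nat)
    (A : set (term ar V * term ar V)) (L : set (term ar V)) : \bar K :=
  ereal_sup ([set 0] `|`
             [set dl t A | t in [set t | L t /\ (tsize t <= n)%N]]).

Definition bigO (f g : nat -> \bar K) : Prop :=
  exists (M : K) (N : nat), forall n, (N <= n)%N -> f n <= M%:E * g n.

End Complexity.

Arguments dl K {T} t A.
Arguments cp K {F ar V} n A L.

(* Main.v *)
(** Along a derivation of [(R1 `|` R2) / S] from [t], follow the potential
    [dl K u gt] of the current term [u]: an [S]-step does not increase it, an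
    [R2]-step decreases it by at least one, and an [R1]-step increases it by at
    most [Delta].  Hence [m1] steps with [R1] and [m2] steps with [R2] satisfy
    [m2 <= dl K t gt + Delta * m1], while [m1 <= dl K t (R1 / (R2 `|` S))].
    The constant [1 + `|Delta|] therefore works for every [n].  Infinite
    suprema are harmless. *)

Require Import Defs.
From mathcomp Require Import all_boot all_order all_algebra.
From mathcomp Require Import mathcomp_extra boolp classical_sets cardinality.
From mathcomp Require Import constructive_ereal reals ereal.

Import Order.TTheory GRing.Theory Num.Theory.
Local Open Scope classical_set_scope.
Local Open Scope ereal_scope.

Lemma rpow_cat {T : Type} (A : set (T * T)) (m k : nat) (t u v : T) :
  rpow A m (t, u) -> rpow A k (u, v) -> rpow A (m + k) (t, v).
Proof.
elim: m t => [|m IH] t /=; first by rewrite /diagonal /= => ->.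
by case=> w /= Atw Awu Auv; exists w => //; apply: IH.
Qed.

Lemma rstar_trans {T : Type} (A : set (T * T)) (t u v : T) :
  rstar A (t, u) -> rstar A (u, v) -> rstar A (t, v).
Proof.
by move=> [m _ Atu] [k _ Auv]; exists (m + k)%N => //; apply: rpow_cat Auv.
Qed.

Lemma rstar1 {T : Type} (A : set (T * T)) (t u : T) :
  A (t, u) -> rstar A (t, u).
Proof. by move=> Atu; exists 1%N => //; exists u. Qed.

Lemma rstar_mono {T : Type} (A B : set (T * T)) :
  A `<=` B -> rstar A `<=` rstar B.
Proof.
move=> AB [t u] [m _ Atu]; exists m => //.
elim: m t Atu => [//|m IH] t [w /= Atw Awu].
by exists w; [exact: AB | exact: IH].
Qed.

Section Rewriting.
Context {F : Type} {ar : F -> nat} {V : Type}.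
Implicit Types R S A : set (term ar V * term ar V).

Lemma rstep_mono R S : R `<=` S -> rstep R `<=` rstep S.
Proof.
move=> RS p [C [s [l [r [Rlr pl pr]]]]].
by exists C, s, l, r; split=> //; apply: RS.
Qed.

Lemma rstep_setU R S p : rstep (R `|` S) p -> rstep R p \/ rstep S p.
Proof.
by move=> [C [s [l [r [[Rlr|Slr] pl pr]]]]]; [left|right]; exists C, s, l, r.
Qed.

Lemma rstep_sub R A : rewrite_relation A -> R `<=` A -> rstep R `<=` A.
Proof.
move=> [Actx Asub] RA [u v] [C [s [l [r [Rlr /= -> ->]]]]].
by apply/Actx/Asub/RA.
Qed.

(** The [S]-steps are absorbed by the [S]-prefix of the first relative step. For [m = 0] there is no
    step to absorb them and the derivation ends in [t] instead of [v]; hence the existential [w]. *)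
Lemma rstep_rel_prefix R S m t u v :
  rstar (rstep S) (t, u) -> rpow (rstep_rel R S) m (u, v) ->
  exists w, rpow (rstep_rel R S) m (t, w).
Proof.
case: m => [|m] Stu; first by exists t.
move=> [w [a /= Sua aw] wv]; exists v, w => //.
by exists a => //=; apply: rstar_trans Sua.
Qed.

End Rewriting.

Section DerivationLength.
Context {K : realType} {T : Type}.
Implicit Types (A gt ge : set (T * T)).

Lemma dl_ub A m t u : rpow A m (t, u) -> m%:R%:E <= dl K t A.
Proof. by move=> Atu; apply: ereal_sup_ubound; exists m => //; exists u. Qed.

Lemma dl_ge0 A t : 0 <= dl K t A.
Proof. exact: (dl_ub A 0 t t). Qed.

Lemma dl_step A t u : A (t, u) -> dl K u A + 1 <= dl K t A.
Proof.
move=> Atu; rewrite -leeBrDr//; apply: ge_ereal_sup => _ [m [v Auv] <-].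
rewrite leeBrDr// -EFinD natr1.
by apply: (dl_ub A m.+1 t v); exists u.
Qed.

(** Compatibility lets the first [gt]-step from [u] swallow the [ge]-steps before it, so every
    nonempty [gt]-derivation from [u] has a counterpart of the same length from [t]. *)
Lemma dl_compat gt ge t u :
  rcomp ge gt `<=` gt -> rstar ge (t, u) -> dl K u gt <= dl K t gt.
Proof.
move=> compat [m _]; elim: m t => [|m IH] t /=; first by rewrite /diagonal /= => ->.
case=> v /= getv /IH /le_trans; apply.
apply: ge_ereal_sup => _ [[|k] [w gtvw] <-]; first exact: dl_ge0.
case: gtvw => x /= gtvx gtxw; apply: (dl_ub gt k.+1 t w).
by exists x => //; apply: compat; exists v.
Qed.

End DerivationLength.

Section Complexity.
Context {K : realType} {F : Type} {ar : F -> nat} {V : Type}.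
Implicit Types (A : set (term ar V * term ar V)) (L : set (term ar V)).

Lemma dl_le_cp A L n t :
  L t -> (Defs.tsize t <= n)%N -> dl K t A <= cp K n A L.
Proof. by move=> Lt tn; apply: ereal_sup_ubound; right; exists t. Qed.

Lemma cp_ge0 A L n : 0 <= cp K n A L.
Proof. by apply: ereal_sup_ubound; left. Qed.

(** Each [R1]-step yields one relative step, while [R2]-steps merge into the background steps. Only
    the length [m1] of the resulting derivation matters later, so its end [w] may differ from
    [u]. *)
Lemma rpow_rstep_rel_split (R1 R2 S gt ge : set (term ar V * term ar V))
    (d : K) m t u :
  complexity_pair gt ge -> R2 `<=` gt -> S `<=` ge ->
  (forall u v, rstep R1 (u, v) -> dl K v gt <= dl K u gt + d%:E) ->
  rpow (rstep_rel (R1 `|` R2) S) m (t, u) ->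
  exists m1 m2 w, [/\ m = (m1 + m2)%N,
    rpow (rstep_rel R1 (R2 `|` S)) m1 (t, w) &
    m2%:R%:E <= dl K t gt + (d * m1%:R)%:E].
Proof.
move=> cpair R2gt Sge R1d.
have dlS a b : rstar (rstep S) (a, b) -> dl K b gt <= dl K a gt.
  move=> Sab; apply: (dl_compat gt ge); first exact: cpair_compatl cpair.
  by apply: rstar_mono Sab; apply: rstep_sub => //; apply: cpair_ge cpair.
have S_R2S : rstar (rstep S) `<=` rstar (rstep (R2 `|` S)).
  by apply/rstar_mono/rstep_mono => p; right.
elim: m t => [|m IH] t.
  by move=> _; exists 0%N, 0%N, t; split=> //; rewrite mulr0 adde0 dl_ge0.
case=> t' [a /= Sta [b /= Rab Sbt']] /IH[m1 [m2 [w [-> t'w m2le]]]].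
case/rstep_setU: Rab => [R1ab|R2ab].
(* The potential at [t'] is at most that at [t] plus [d]; this [d] matches the growth of [m1] by
   one. *)
- exists m1.+1, m2, w; split=> //.
    by exists t' => //; exists a; [exact: S_R2S|exists b => //; exact: S_R2S].
  apply: le_trans m2le _; rewrite -natr1 mulrDr mulr1 EFinD addeA addeAC.
  apply: leeD2r; apply: le_trans (dlS _ _ Sbt') _.
  by apply: le_trans (R1d _ _ R1ab) _; apply: leeD2r; apply: dlS.
(* The potential at [t] is at least that at [t'] plus one, which pays for the growth of [m2]; the
   step itself joins the prefix of the remaining derivation. *)
- have gtab : gt (a, b) by apply: rstep_sub R2ab => //; apply: cpair_gt cpair.
  have R2Stt' : rstar (rstep (R2 `|` S)) (t, t').
    apply: rstar_trans (S_R2S _ Sta) _; apply: rstar_trans (S_R2S _ Sbt').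
    by apply/rstar1; apply: rstep_mono R2ab => p; left.
  have [w' tw'] := rstep_rel_prefix _ _ _ _ _ _ R2Stt' t'w.
  exists m1, m2.+1, w'; split=> //; first by rewrite addnS.
  rewrite -natr1 EFinD; apply: le_trans (leeD2r 1 m2le) _.
  rewrite addeAC; apply: leeD2r; apply: le_trans (dlS _ _ Sta).
  by apply: le_trans (dl_step _ _ _ gtab); apply: leeD2r; apply: dlS.
Qed.

End Complexity.

Theorem theorem4p6 (K : realType) (F : Type) (ar : F -> nat) (V : Type)
    (R1 R2 S : set (term ar V * term ar V)) (L : set (term ar V))
    (trs1 : is_TRS R1) (trs2 : is_TRS R2) (trsS : is_TRS S)
    (termL : forall t, L t -> terminating (rstep_rel (R1 `|` R2) S) t)
    (gt ge : set (term ar V * term ar V)) (Delta : K)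
    (cpair : complexity_pair gt ge)
    (R2gt : R2 `<=` gt) (Sge : S `<=` ge)
    (R1Delta : forall u v, rstep R1 (u, v) ->
       dl K v gt <= dl K u gt + Delta%:E) :
  bigO (fun n => cp K n (rstep_rel (R1 `|` R2) S) L)
       (fun n => cp K n (rstep_rel R1 (R2 `|` S)) L + cp K n gt L).
Proof.
exists (1 + `|Delta|)%R, 0%N => n _.
set c1 := cp K n (rstep_rel R1 (R2 `|` S)) L; set c2 := cp K n gt L.
have M_ge1 : 1 <= (1 + `|Delta|)%:E by rewrite lee_fin lerDl normr_ge0.
(* The first case is the element 0 adjoined in [cp]: the right-hand side has to be nonnegative. *)
apply: ge_ereal_sup => _ [-> | [t [Lt tn] <-]].
  apply: mule_ge0; first exact: le_trans M_ge1.
  by apply: adde_ge0; apply: cp_ge0.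
apply: ge_ereal_sup => _ [m [u tu] <-].
have [m1 [m2 [w [-> tw m2le]]]] :=
  rpow_rstep_rel_split _ _ _ _ _ _ _ _ _ cpair R2gt Sge R1Delta tu.
have m1le : m1%:R%:E <= c1.
  exact: le_trans (dl_ub _ _ _ _ tw) (dl_le_cp _ _ _ _ Lt tn).
rewrite ge0_muleDr; [|exact: cp_ge0|exact: cp_ge0].
(* Keeping the finite [m1] in place of the possibly infinite [c1] lets the product be expanded in
   [K]: the summand [m1] covers the [R1]-steps, the rest bounds [m2]. *)
apply: (@le_trans _ _ ((1 + `|Delta|)%:E * m1%:R%:E + c2)); last first.
  apply: leeD; first by apply: lee_wpmul2l => //; apply: le_trans M_ge1.
  by rewrite -{1}[c2]mul1e; apply: lee_wpmul2r => //; apply: cp_ge0.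
rewrite natrD EFinD -EFinM mulrDl mul1r EFinD -addeA.
apply: leeD => //; apply: le_trans m2le _; rewrite addeC.
apply: leeD; first exact: dl_le_cp.
by rewrite lee_fin; apply: ler_wpM2r => //; apply: ler_norm.
Qed.
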